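(* Consider the system described in the context, with $\theta(z)=z$ and selection policy $\mathbf{P}_{\vec a}$, where $\{a_i,i\ge1\}$ is a non-decreasing sequence of positive weights with $\lim_{i\to\infty}a_i=1$. (i) The system is never ergodic when $\varphi'(1)=\infty$. (ii) When $\varphi'(1)<\infty$, the system is ergodic if, and only if, $$\frac{\alpha}{\lambda}\le\sum_{k=1}^\infty\sum_{j=0}^\infty\frac{A_{j+k}\Phi_j}{A_j},$$ where the right-hand side of this inequality may be infinite.
   Context: Parameters: $\lambda,\alpha>0$, $\mu>0$; $\{\varphi_k,k\ge1\}$ is a proper probability distribution on the positive integers with generating function $\varphi(z)=\sum_{i\ge1}\varphi_iz^i$, and $\frac{1-\varphi(z)}{1-z}=\sum_{n\ge0}\Phi_nz^n$ (so $\Phi_n=\sum_{k>n}\varphi_k$). The score of a visited POI increases by exactly one, i.e. $\theta(z)=z$. The dynamical system $\vec r(t)=(r_i(t))_{i\ge1}$ of non-negative sequences is governed by $$\frac{\mathrm{d}r_i(t)}{\mathrm{d}t}=\lambda\varphi_i+\mu\bigl[r_{i+1}(t)-r_i(t)\bigr]+\alpha\bigl[\pi_{i-1}(\vec r(t))-\pi_i(\vec r(t))\bigr],\qquad i\ge1,$$ with $\pi_0(\cdot)=0$. Policy $\mathbf{P}_{\vec a}$: each score $i\ge1$ has a positive weight $a_i$, and $$\pi_i(\vec r)=\frac{a_ir_i}{K},\qquad K=\sum_{j\ge1}a_jr_j .$$ A stationary regime $\vec r=(r_i)_{i\ge1}$ satisfies $$r_{n+1}=\frac{\alpha}{\mu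 K}a_nr_n+\frac{\lambda}{\mu}\Phi_n,\qquad n\ge0$$ (the first term being absent for $n=0$). Put $A_n=\prod_{i=1}^na_i$, $A_0=1$. Ergodicity: the system is called ergodic if it has a finite stationary regime $\vec r$ such that $r(1)=\sum_{i\ge1}r_i<\infty$ and $\overline{\pi}=\sum_{i\ge1}\pi_i(\vec r)=1$ (so in particular with $0<K<\infty$). *)

(* Defs.v *)
From HB Require Import structures.
From mathcomp Require Import all_boot all_order all_algebra.
From mathcomp Require Import all_classical all_reals all_analysis.
Set Implicit Arguments.
Unset Strict Implicit.
Unset Printing Implicit Defensive.
Import Order.TTheory GRing.Theory Num.Theory.
Import numFieldNormedType.Exports.
Local Open Scope classical_set_scope.
Local Open Scope ring_scope.

(* Sequences indexed by the positive integers are functions on nat; their value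
   at 0 is never used. *)

Definition proba_pos (R : realType) (phi : nat -> R) : Prop :=
  (forall i, (1 <= i)%N -> 0 <= phi i) /\
  (\sum_(1 <= i <oo) (phi i)%:E = 1)%E.

Definition genfun (R : realType) (phi : nat -> R) (z : R) : R :=
  \big[+%R/0]_(1 <= i <oo) (phi i * z ^+ i).

(* phi'(1): in general genfun phi is only defined on [-1, 1], so this is the
   left derivative at 1, which may be +oo. *)
Definition genfun_deriv1 (R : realType) (phi : nat -> R) : \bar R :=
  lim (((genfun phi 1 - genfun phi z) / (1 - z))%:E @[z --> 1^'-]).

Definition tail (R : realType) (phi : nat -> R) (n : nat) : R :=
  \big[+%R/0]_(n.+1 <= k <oo) phi k.

Definition weight_prod (R : realType) (a : nat -> R) (n : nat) : R :=
  \prod_(1 <= i < n.+1) a i.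

Definition total_weight (R : realType) (a r : nat -> R) : \bar R :=
  (\sum_(1 <= j <oo) (a j * r j)%:E)%E.

(* If the total weight K is 0 or +oo, the division is by 0 and yields 0; hence
   sum_i selection a r i = 1 forces 0 < K < +oo. *)
Definition selection (R : realType) (a r : nat -> R) (i : nat) : R :=
  if i == 0%N then 0 else a i * r i / fine (total_weight a r).

Definition drift (R : realType) (lambda mu alpha : R) (phi a r : nat -> R)
    (i : nat) : R :=
  lambda * phi i + mu * (r i.+1 - r i)
  + alpha * (selection a r i.-1 - selection a r i).

(* A non-negative fixed point of dr_i/dt = drift_i(r). *)
Definition stationary_regime (R : realType) (lambda mu alpha : R)
    (phi a r : nat -> R) : Prop :=
  forall i, (1 <= i)%N -> 0 <= r i /\ drift lambda mu alpha phi a r i = 0.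

Definition ergodic (R : realType) (lambda mu alpha : R)
    (phi a : nat -> R) : Prop :=
  exists r : nat -> R,
    [/\ stationary_regime lambda mu alpha phi a r,
        (\sum_(1 <= i <oo) (r i)%:E < +oo)%E &
        (\sum_(1 <= i <oo) (selection a r i)%:E = 1)%E].

(* Main.v *)
(** In a stationary regime with total weight K, the balance equations make the
selection probabilities a multiple [lambda / alpha] of the flow
[f_(n+1) = a_(n+1) x (f_n + Phi_n)], [f_0 = 0], with [x = alpha / (mu K)], so
ergodicity amounts to [sum Phi_n < oo] together with the existence of [x > 0]
such that [sum_n f_n(x) = alpha / lambda].  Since [a_n --> 1] this forces
[x <= 1].  On [[0, 1]] the sum increases from 0 to its value at [x = 1], which
is the double series of the criterion, and summing the recursion bounds the
increments of the partial sums uniformly, so the intermediate value theorem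
provides [x].  Finally [phi'(1) = sum Phi_n], by squeezing the slopes
[(1 - phi(z)) / (1 - z) = sum Phi_n z^n]. *)
Require Import Defs.
From mathcomp Require Import all_boot all_order all_algebra.
From mathcomp Require Import all_classical all_reals all_analysis.
From mathcomp Require Import zify ring lra.
Import Order.TTheory GRing.Theory Num.Theory.
Import numFieldNormedType.Exports.
Local Open Scope classical_set_scope.
Local Open Scope ring_scope.
Set Implicit Arguments.
Unset Strict Implicit.

(** * Partial sums of non-negative series *)

Lemma sum_le_nneseries (R : realType) (f : nat -> R) m n :
  (forall i, (m <= i)%N -> 0 <= f i) ->
  ((\sum_(m <= i < n) f i)%:E <= \sum_(m <= i <oo) (f i)%:E)%E.
Proof.
move=> f0; rewrite -sumEFin; apply: nneseries_lim_ge => i mi _.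
by rewrite lee_fin f0.
Qed.

Lemma nneseries_le_ub (R : realType) (f : nat -> R) m (M : R) :
  (forall i, (m <= i)%N -> 0 <= f i) ->
  (forall n, \sum_(m <= i < n) f i <= M) ->
  (\sum_(m <= i <oo) (f i)%:E <= M%:E)%E.
Proof.
move=> f0 fM; apply: lime_le.
  by apply: is_cvg_nneseries => i mi _; rewrite lee_fin f0.
by near=> n; rewrite sumEFin lee_fin.
Unshelve. all: by end_near. Qed.

Lemma lt_nneseries (R : realType) (f : nat -> R) m (c : R) :
  (forall i, (m <= i)%N -> 0 <= f i) ->
  (c%:E < \sum_(m <= i <oo) (f i)%:E)%E ->
  exists n, c < \sum_(m <= i < n) f i.
Proof.
move=> f0 cf; apply/not_existsP => H; move: cf; apply/negP; rewrite -leNgt.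
by apply: nneseries_le_ub => // n; rewrite leNgt; apply/negP.
Qed.

Lemma nneseries_cvg_sum (R : realType) (f : nat -> R) m (L : R) :
  (forall i, (m <= i)%N -> 0 <= f i) ->
  (\sum_(m <= i <oo) (f i)%:E = L%:E)%E ->
  \sum_(m <= i < n) f i @[n --> \oo] --> L.
Proof.
move=> f0 fL.
have : (\sum_(m <= i < n) (f i)%:E)%E @[n --> \oo] --> L%:E.
  rewrite -fL; apply: is_cvg_nneseries => i mi _.
  by rewrite lee_fin f0.
under eq_cvg do rewrite sumEFin.
by move/fine_cvgP => [_].
Qed.

Lemma nneseries_fin (R : realType) (f : nat -> R) m :
  (forall i, (m <= i)%N -> 0 <= f i) ->
  (\sum_(m <= i <oo) (f i)%:E < +oo)%E ->
  (\sum_(m <= i <oo) (f i)%:E = (fine (\sum_(m <= i <oo) (f i)%:E))%:E)%E.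
Proof.
move=> f0 foo; rewrite fineK// ge0_fin_numE//.
by apply: nneseries_ge0 => i mi _; rewrite lee_fin f0.
Qed.

Lemma nneseries_cvg0 (R : realType) (f : nat -> R) m :
  (forall i, (m <= i)%N -> 0 <= f i) ->
  (\sum_(m <= i <oo) (f i)%:E < +oo)%E -> f n @[n --> \oo] --> 0.
Proof.
move=> f0 foo; apply: cvg_series_cvg_0.
rewrite -(is_cvg_series_restrict m); apply/cvg_ex; eexists.
exact: nneseries_cvg_sum (nneseries_fin f0 foo).
Qed.

(** * Tails of the batch distribution *)

Lemma tailE (R : realType) (phi : nat -> R) n : proba_pos phi ->
  tail phi n = 1 - \sum_(1 <= i < n.+1) phi i.
Proof.
move=> [phi0 /(nneseries_cvg_sum phi0) phi1].
apply/cvg_lim => //; rewrite -(cvg_shiftn n.+1).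
have -> : (fun k => \sum_(n.+1 <= i < k + n.+1) phi i) =
    (fun k => \sum_(1 <= i < k + n.+1) phi i - \sum_(1 <= i < n.+1) phi i).
  apply/funext => k; rewrite [in RHS](@big_cat_nat _ _ _ n.+1) //= ?leq_addl//.
  by rewrite addrAC subrr add0r.
apply: cvgB; last exact: cvg_cst.
by rewrite (cvg_shiftn n.+1 (fun k => \sum_(1 <= i < k) phi i)).
Qed.

Lemma tail0 (R : realType) (phi : nat -> R) : proba_pos phi -> tail phi 0 = 1.
Proof. by move=> phiP; rewrite tailE// big_nil subr0. Qed.

Lemma tailS (R : realType) (phi : nat -> R) n : proba_pos phi ->
  phi n.+1 = tail phi n - tail phi n.+1.
Proof.
by move=> phiP; rewrite !tailE// (@big_nat_recr _ _ _ n.+1)//=; ring.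
Qed.

Lemma tail_ge0 (R : realType) (phi : nat -> R) n : proba_pos phi ->
  0 <= tail phi n.
Proof.
move=> phiP; rewrite tailE// subr_ge0 -lee_fin -phiP.2.
exact: sum_le_nneseries phiP.1.
Qed.

Lemma cvg_tail (R : realType) (phi : nat -> R) : proba_pos phi ->
  tail phi n @[n --> \oo] --> 0.
Proof.
move=> phiP; have -> : tail phi = fun n => 1 - \sum_(1 <= i < n.+1) phi i.
  by apply/funext => n; rewrite tailE.
rewrite -[X in _ --> X](subrr 1); apply: cvgB; first exact: cvg_cst.
by rewrite (cvg_shiftS (fun k => \sum_(1 <= i < k) phi i));
  exact: (nneseries_cvg_sum phiP.1 phiP.2).
Qed.

(** * Generating function and its slope at 1 *)

(** Abel summation, based on [phi k.+1 = tail phi k - tail phi k.+1]; the last term is the boundary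
    term. *)
Lemma genfun_sumE (R : realType) (phi : nat -> R) z N : proba_pos phi ->
  \sum_(1 <= i < N.+1) phi i * z ^+ i =
  1 - (1 - z) * (\sum_(0 <= k < N) tail phi k * z ^+ k) - tail phi N * z ^+ N.
Proof.
move=> phiP; elim: N => [|N IH]; first by rewrite !big_nil tail0// expr0; ring.
by rewrite big_nat_recr//= IH [in RHS]big_nat_recr//= tailS// exprS; ring.
Qed.

Lemma cvg_genfun (R : realType) (phi : nat -> R) z : proba_pos phi ->
  0 <= z <= 1 ->
  \sum_(1 <= i < N) phi i * z ^+ i @[N --> \oo] --> genfun phi z.
Proof.
move=> phiP /andP[z0 z1].
have f0 i : (1 <= i)%N -> 0 <= phi i * z ^+ i.
  by move=> i1; rewrite mulr_ge0 ?exprn_ge0// phiP.1.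
have foo : (\sum_(1 <= i <oo) (phi i * z ^+ i)%:E < +oo)%E.
  apply: (@le_lt_trans _ _ 1%:E); last exact: ltry.
  apply: nneseries_le_ub => // n; rewrite -lee_fin -phiP.2.
  apply: le_trans (sum_le_nneseries n phiP.1).
  rewrite lee_fin; apply: ler_sum_nat => i /andP[i1 _].
  by rewrite ler_piMr ?phiP.1// exprn_ile1.
by apply/cvg_ex; eexists; exact: nneseries_cvg_sum (nneseries_fin f0 foo).
Qed.

Lemma genfun1 (R : realType) (phi : nat -> R) : proba_pos phi ->
  genfun phi 1 = 1.
Proof.
move=> phiP; apply/cvg_lim => //.
under eq_cvg do under eq_bigr do rewrite expr1n mulr1.
exact: (nneseries_cvg_sum phiP.1 phiP.2).
Qed.

Lemma genfun_slope_le (R : realType) (phi : nat -> R) z (S : R) :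
  proba_pos phi -> 0 <= z < 1 ->
  (\sum_(0 <= k <oo) (tail phi k)%:E <= S%:E)%E ->
  (genfun phi 1 - genfun phi z) / (1 - z) <= S.
Proof.
move=> phiP /andP[z0 z1] tS; rewrite genfun1// ler_pdivrMr ?subr_gt0//.
have -> : genfun phi z = lim (\sum_(1 <= i < N.+1) phi i * z ^+ i @[N --> \oo]).
  apply/esym/cvg_lim => //.
  rewrite (cvg_shiftS (fun N => \sum_(1 <= i < N) phi i * z ^+ i)).
  by apply: cvg_genfun; rewrite ?z0 ?ltW.
rewrite lerBlDr -lerBlDl.
(* The vanishing [tail phi N] is subtracted so that it dominates the boundary term of the Abel
   summation at each finite [N]. *)
have -> : 1 - S * (1 - z) = lim ((1 - S * (1 - z) - tail phi N) @[N --> \oo]).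
  apply/esym/cvg_lim => //; rewrite -[X in _ --> X]subr0.
  by apply: cvgB; [exact: cvg_cst|exact: cvg_tail].
apply: ler_lim.
- apply/cvg_ex; eexists; apply: cvgB; [exact: cvg_cst|exact: cvg_tail].
- apply/cvg_ex; exists (genfun phi z).
  rewrite (cvg_shiftS (fun N => \sum_(1 <= i < N) phi i * z ^+ i)).
  by apply: cvg_genfun; rewrite ?z0 ?ltW.
near=> N; rewrite genfun_sumE//.
have t0 k : (0 <= k)%N -> 0 <= tail phi k by move=> _; exact: tail_ge0.
have zN k : z ^+ k <= 1 by rewrite exprn_ile1// ltW.
apply: lerB; last by rewrite ler_piMr ?tail_ge0.
rewrite lerD2l lerN2 mulrC; apply: ler_wpM2r; first by rewrite subr_ge0 ltW.
rewrite -lee_fin (le_trans _ tS)//.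
apply: le_trans (sum_le_nneseries N t0).
by rewrite lee_fin; apply: ler_sum_nat => i _; rewrite ler_piMr ?t0.
Unshelve. all: by end_near. Qed.

(** In the Abel summation, dropping the boundary term and the tails of index at least [N] can only
    raise the bound on [genfun phi z], hence lower the slope. *)
Lemma genfun_slope_ge (R : realType) (phi : nat -> R) z N :
  proba_pos phi -> 0 <= z < 1 ->
  \sum_(0 <= k < N) tail phi k * z ^+ k <=
    (genfun phi 1 - genfun phi z) / (1 - z).
Proof.
move=> phiP /andP[z0 z1]; rewrite genfun1// ler_pdivlMr ?subr_gt0//.
rewrite lerBrDr -lerBrDl; apply: limr_le.
  by apply/cvg_ex; exists (genfun phi z); apply: cvg_genfun; rewrite ?z0 ?ltW.
near=> M.
have [M' -> NM] : exists2 M', M = M'.+1 & (N <= M')%N.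
  by exists M.-1; near: M; exists N.+1 => // -[].
rewrite genfun_sumE// -[leRHS]subr0; apply: lerB; last first.
  by rewrite mulr_ge0 ?tail_ge0 ?exprn_ge0.
rewrite lerD2l lerN2 mulrC; apply: ler_wpM2l; first by rewrite subr_ge0 ltW.
rewrite (big_cat_nat _ NM)//= lerDl sumr_ge0// => i _.
by rewrite mulr_ge0 ?tail_ge0 ?exprn_ge0.
Unshelve. all: by end_near. Qed.

Lemma genfun_deriv1_fin (R : realType) (phi : nat -> R) : proba_pos phi ->
  (\sum_(0 <= k <oo) (tail phi k)%:E < +oo)%E -> genfun_deriv1 phi <> +oo%E.
Proof.
move=> phiP tfin.
have tS := nneseries_fin (fun k _ => tail_ge0 k phiP) tfin.
rewrite /genfun_deriv1; set F := (X in lim X).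
(* Without convergence, [lim] is a default value, which differs from [+oo]. *)
have [cF|ncF] := pselect (cvg F); last first.
  by rewrite dvgP.
suff : (lim F < +oo)%E by move=> + E; rewrite E.
apply: (le_lt_trans _ tfin); rewrite tS; apply: lime_le => //.
near=> z; rewrite lee_fin; apply: genfun_slope_le => //; last by rewrite -tS.
apply/andP; split; last by near: z; exact: nbhs_left_lt.
by apply: ltW; near: z; exact: nbhs_left_gt.
Unshelve. all: by end_near. Qed.

(** A finite sum of tails exceeding [A] is the value at 1 of a polynomial that bounds the slopes
    from below; by continuity the slopes exceed [A] near 1. *)
Lemma genfun_deriv1_infty (R : realType) (phi : nat -> R) : proba_pos phi ->
  (\sum_(0 <= k <oo) (tail phi k)%:E = +oo)%E -> genfun_deriv1 phi = +oo%E.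
Proof.
move=> phiP too; apply/cvg_lim => //; apply/cvgeyPgt => A.
have [|N AN] := @lt_nneseries R (tail phi) 0 A (fun k _ => tail_ge0 k phiP).
  by rewrite too ltry.
have cP : \sum_(0 <= k < N) tail phi k * z ^+ k @[z --> 1^'-] -->
    \sum_(0 <= k < N) tail phi k.
  apply: cvg_at_left_filter.
  under [X in _ --> X]eq_bigr => k _ do
    rewrite -(mulr1 (tail phi k)) -(expr1n R k).
  apply: cvg_big => [|k _]; first exact: add_continuous.
  apply: cvgM; first exact: cvg_cst.
  exact: exprn_continuous.
near=> z; rewrite lte_fin; apply: lt_le_trans (genfun_slope_ge N _ _) => //.
  by near: z; apply: (cvgr_gt _ cP).
apply/andP; split; last by near: z; exact: nbhs_left_lt.
by apply: ltW; near: z; exact: nbhs_left_gt.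
Unshelve. all: by end_near. Qed.

(** * Summation of a double series along diagonals *)

Lemma nneseries_diag (R : realType) (f : nat -> nat -> \bar R) :
  (forall n j, 0 <= f n j)%E ->
  (\sum_(1 <= k <oo) \sum_(0 <= j <oo) f (j + k)%N j =
   \sum_(0 <= n <oo) \sum_(0 <= j < n) f n j)%E.
Proof.
move=> f0.
rewrite -(nneseries_addn (f := fun k => (\sum_(0 <= j <oo) f (j + k)%N j)%E));
  last by move=> k; apply: nneseries_ge0.
rewrite (nneseries_interchange _ _ (fun k j => f0 (j + (k + 1))%N j)).
(* With [n = j + k], the condition [k >= 1] reads [j < n]. Padding by zeros turns this triangle into
   a full quadrant, where the sums can be interchanged again. *)
transitivity (\sum_(0 <= j <oo) \sum_(0 <= n <oo)
    (if (j < n)%N then f n j else 0))%E.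
  apply: eq_eseriesr => j _; rewrite -eseries_mkcond.
  under eq_eseriesr do rewrite addnCA addn1.
  by rewrite (nneseries_addn (f := f^~ j))// eseries_cond.
rewrite nneseries_interchange; last by move=> j n; case: ifP.
apply: eq_eseriesr => n _.
rewrite (nneseries_split 0 n); last by move=> j _; case: ifP.
rewrite add0n [X in (_ + X)%E]eseries0 ?adde0; last first.
  by move=> j nj _; rewrite ltnNge nj.
by apply: eq_big_nat => j /andP[_ ->].
Qed.

(** * The flow recursion *)

Fixpoint flow (R : realType) (a w : nat -> R) (x : R) (n : nat) : R :=
  if n is m.+1 then a n * x * (flow a w x m + w m) else 0.

Definition flow_sum (R : realType) (a w : nat -> R) (n : nat) (x : R) : R :=
  \sum_(0 <= i < n) flow a w x i.

Lemma weight_prodS (R : realType) (a : nat -> R) n :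
  weight_prod a n.+1 = weight_prod a n * a n.+1.
Proof. by rewrite /weight_prod big_nat_recr. Qed.

Lemma weight_prod_gt0 (R : realType) (a : nat -> R) n :
  (forall i, (1 <= i)%N -> 0 < a i) -> 0 < weight_prod a n.
Proof.
move=> a0; elim: n => [|n IH]; first by rewrite /weight_prod big_nil.
by rewrite weight_prodS mulr_gt0 ?a0.
Qed.

(** Unrolling the linear recursion: the input [w j] reaches index [n] multiplied by the weights from
    [j.+1] to [n], a quotient of two weight products. *)
Lemma flow1E (R : realType) (a w : nat -> R) n :
  (forall i, (1 <= i)%N -> 0 < a i) ->
  flow a w 1 n = \sum_(0 <= j < n) weight_prod a n * w j / weight_prod a j.
Proof.
move=> a0; elim: n => [|n IH]; first by rewrite big_nil.
have An := lt0r_neq0 (weight_prod_gt0 n a0).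
rewrite big_nat_recr//= IH mulr1 mulrDr mulr_sumr; congr (_ + _); last first.
  by rewrite weight_prodS; field.
by apply: eq_bigr => j _; rewrite weight_prodS; ring.
Qed.

Lemma flow_continuous (R : realType) (a w : nat -> R) n :
  continuous (fun x => flow a w x n).
Proof.
elim: n => [|n IH] x /=; first exact: cvg_cst.
apply: cvgM; first by apply: cvgM; [exact: cvg_cst|exact: cvg_id].
by apply: cvgD; [exact: IH|exact: cvg_cst].
Qed.

Lemma flow_sum_continuous (R : realType) (a w : nat -> R) n :
  continuous (flow_sum a w n).
Proof.
apply: continuous_big => [|i _]; first exact: add_continuous.
exact: flow_continuous.
Qed.

(** * Monotonicity and bounds uniform in the number of terms *)

Section flow_bounds.
Variables (R : realType) (a w : nat -> R).
Hypothesis a_gt0 : forall i, (1 <= i)%N -> 0 < a i.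
Hypothesis a_le1 : forall i, (1 <= i)%N -> a i <= 1.
Hypothesis w_ge0 : forall i, 0 <= w i.

Lemma flow_ge0 x n : 0 <= x -> 0 <= flow a w x n.
Proof.
move=> x0; elim: n => //= n IH.
by rewrite mulr_ge0 ?addr_ge0// mulr_ge0// ltW// a_gt0.
Qed.

Lemma ler_flow x z n : 0 <= x -> x <= z -> flow a w x n <= flow a w z n.
Proof.
move=> x0 xz; elim: n => //= n IH.
have an := ltW (a_gt0 (ltn0Sn n)).
apply: ler_pM; rewrite ?addr_ge0 ?flow_ge0 ?mulr_ge0//.
  exact: ler_wpM2l.
by rewrite lerD2r.
Qed.

Lemma flow_sumS n x :
  flow_sum a w n.+1 x = flow_sum a w n x + flow a w x n.
Proof. by rewrite /flow_sum big_nat_recr. Qed.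

Lemma ler_flow_sum x z n : 0 <= x -> x <= z ->
  flow_sum a w n x <= flow_sum a w n z.
Proof. by move=> x0 xz; apply: ler_sum_nat => i _; exact: ler_flow. Qed.

(** Sum the recursion over the indices and bound each weight by 1. *)
Lemma flow_sum_rec x n : 0 <= x ->
  flow_sum a w n.+1 x <= x * (flow_sum a w n x + \sum_(0 <= i < n) w i).
Proof.
move=> x0; elim: n => [|n IH].
  by rewrite /flow_sum big_nat1 big_nil/= big_nil addr0 mulr0.
rewrite (flow_sumS n.+1) (@big_nat_recr _ _ _ n)//= mulrDr.
move: IH; rewrite (flow_sumS n) => IH.
have := ler_wpM2r (mulr_ge0 x0 (addr_ge0 (flow_ge0 n x0) (w_ge0 n)))
  (a_le1 (ltn0Sn n)).
lra.
Qed.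

Lemma flow_sum_nondecreasing x m n : 0 <= x -> (m <= n)%N ->
  flow_sum a w m x <= flow_sum a w n x.
Proof.
move=> x0 mn; rewrite /flow_sum (big_cat_nat _ mn)//= lerDl.
by apply: sumr_ge0 => i _; exact: flow_ge0.
Qed.

(** Partial sums grow with [n], so [flow_sum_rec] yields [s <= x * (s + S)] for the partial sum [s],
    which is solved for [s] since [x < 1]. *)
Lemma flow_sum_le x n (S : R) : 0 <= x -> x < 1 ->
  (forall m, \sum_(0 <= i < m) w i <= S) -> flow_sum a w n x <= S / (1 - x).
Proof.
move=> x0 x1 wS; rewrite ler_pdivlMr ?subr_gt0//.
have h1 := flow_sum_rec n x0.
have h2 := flow_sum_nondecreasing x0 (leqnSn n).
have h3 := ler_wpM2l x0 (wS n).
have S0 : 0 <= S by have := wS 0; rewrite big_nil.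
have h4 : x * S <= S by rewrite ler_piMl// ltW.
lra.
Qed.

Lemma flow_sum_diff_rec x z n : 0 <= x -> x <= z ->
  flow_sum a w n.+1 z - flow_sum a w n.+1 x <=
  z * (flow_sum a w n z - flow_sum a w n x) +
  (z - x) * (flow_sum a w n x + \sum_(0 <= i < n) w i).
Proof.
move=> x0 xz; elim: n => [|n IH].
  by rewrite /flow_sum !big_nat1 !big_nil/=; lra.
move: IH; rewrite !(flow_sumS n.+1) !(flow_sumS n) => IH.
rewrite (@big_nat_recr _ _ _ n)//=.
(* This is the difference of the two recursion steps without the factor [a n.+1]; being
   non-negative, it only grows when that factor is replaced by 1. *)
have D0 : 0 <= z * (flow a w z n - flow a w x n) +
    (z - x) * (flow a w x n + w n).
  by rewrite addr_ge0// mulr_ge0 ?subr_ge0 ?ler_flow ?addr_ge0 ?flow_ge0//; lra.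
have := ler_wpM2r D0 (a_le1 (ltn0Sn n)); lra.
Qed.

(** The increment [d] satisfies [d <= y * d + (z - x) * (S / (1 - y) + S)], the flow sum at [x]
    being bounded by the one at [y]. The constant is free of [n], so it survives the limit. *)
Lemma flow_sum_lipschitz x z y n (S : R) :
  (forall m, \sum_(0 <= i < m) w i <= S) ->
  0 <= x -> x <= z -> z <= y -> y < 1 ->
  flow_sum a w n z - flow_sum a w n x <=
    (S / (1 - y) + S) / (1 - y) * (z - x).
Proof.
move=> wS x0 xz zy y1.
have S0 : 0 <= S by have := wS 0; rewrite big_nil.
rewrite mulrAC ler_pdivlMr ?subr_gt0//.
have d0 : 0 <= flow_sum a w n z - flow_sum a w n x.
  by rewrite subr_ge0; exact: ler_flow_sum.
have dS : flow_sum a w n z - flow_sum a w n x <=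
    flow_sum a w n.+1 z - flow_sum a w n.+1 x.
  by rewrite !flow_sumS; have := ler_flow n x0 xz; lra.
have h1 := flow_sum_diff_rec n x0 xz.
have h2 : flow_sum a w n x + \sum_(0 <= i < n) w i <= S / (1 - y) + S.
  apply: lerD => //; apply: le_trans (flow_sum_le n _ y1 wS); last by lra.
  by apply: ler_flow_sum => //; lra.
have h3 : 0 <= z - x by lra.
have h4 := ler_wpM2l h3 h2.
have h5 : z * (flow_sum a w n z - flow_sum a w n x) <=
  y * (flow_sum a w n z - flow_sum a w n x) by exact: ler_wpM2r.
lra.
Qed.

Lemma cvg_flow_sum x (S : R) : (forall m, \sum_(0 <= i < m) w i <= S) ->
  0 <= x -> x < 1 -> cvgn (flow_sum a w ^~ x).
Proof.
move=> wS x0 x1; apply: nondecreasing_is_cvgn.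
  by move=> m n; exact: flow_sum_nondecreasing.
by exists (S / (1 - x)) => _ [n _ <-]; exact: flow_sum_le.
Qed.

(* On [0, y] with y < 1 the partial sums are equi-Lipschitz, hence so is their
   limit, and the intermediate value theorem applies to it. *)
Lemma flow_series_ivt (S L : R) : (forall m, \sum_(0 <= i < m) w i <= S) ->
  0 < L -> (L%:E <= \sum_(0 <= n <oo) (flow a w 1 n)%:E)%E ->
  exists x, [/\ 0 < x, x <= 1 & (\sum_(0 <= n <oo) (flow a w x n)%:E = L%:E)%E].
Proof.
move=> wS L0; rewrite le_eqVlt => /predU1P[LE|].
  by exists 1; rewrite ltr01 lexx LE.
move=> /lt_nneseries[i _|N LN]; first exact: flow_ge0.
(* A finite partial sum already exceeds [L] at 1; by continuity it still does at some [y < 1], where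
   the uniform bounds hold. *)
have [y [y0 y1 Ly]] : exists y, [/\ 0 < y, y < 1 & L < flow_sum a w N y].
  have cN : flow_sum a w N y @[y --> 1^'-] --> flow_sum a w N 1.
    by apply: cvg_at_left_filter; exact: flow_sum_continuous.
  near (1 : R)^'- => y; exists y; split.
  - by near: y; exact: nbhs_left_gt.
  - by near: y; exact: nbhs_left_lt.
  - by near: y; exact: (cvgr_gt _ cN).
pose F x := limn (flow_sum a w ^~ x).
have cF x : 0 <= x -> x <= y -> flow_sum a w ^~ x @ \oo --> F x.
  by move=> x0 xy; apply: (cvg_flow_sum wS x0); lra.
set C := (S / (1 - y) + S) / (1 - y).
have Flip x z : 0 <= x -> x <= z -> z <= y -> 0 <= F z - F x <= C * (z - x).
  move=> x0 xz zy.
  have cD : flow_sum a w n z - flow_sum a w n x @[n --> \oo] --> F z - F x.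
    by apply: cvgB; apply: cF => //; lra.
  rewrite -(cvg_lim _ cD)//; apply/andP; split.
    apply: limr_ge; first by apply/cvg_ex; eexists; exact: cD.
    by near=> n; rewrite subr_ge0 ler_flow_sum.
  apply: limr_le; first by apply/cvg_ex; eexists; exact: cD.
  by near=> n; exact: flow_sum_lipschitz.
have Fcont : {within `[0, y], continuous F}.
  apply/subspace_continuousP => x; rewrite /= in_itv/= => /andP[x0 xy].
  apply/cvgrPdist_le => e e0.
  have C0 : 0 <= C.
    have := Flip 0 y (lexx _) (ltW y0) (lexx _); rewrite subr0 => /andP[h1 h2].
    by rewrite -(pmulr_lge0 _ y0) (le_trans h1).
  (* [C] may vanish, hence the radius [e / (C + 1)]. *)
  have C1 : 0 < C + 1 by lra.
  apply/nbhs_ballP; exists (e / (C + 1)) => /=; first by rewrite divr_gt0.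
  move=> z; rewrite /ball/= ltr_pdivlMr// => xz.
  rewrite in_itv/= => /andP[z0 zy].
  rewrite /from_subspace.
  have hC : `|x - z| * C <= `|x - z| * (C + 1) by rewrite ler_wpM2l// lerDl.
  have [xz'|zx'] := leP x z.
    have /andP[h1 h2] := Flip x z x0 xz' zy.
    move: xz hC; rewrite !ler0_norm; [|lra..]; lra.
  have /andP[h1 h2] := Flip z x z0 (ltW zx') xy.
  move: xz hC; rewrite !ger0_norm; [|lra..]; lra.
have F0 : F 0 = 0.
  apply/cvg_lim => //.
  rewrite (_ : flow_sum a w ^~ 0 = cst 0); first exact: cvg_cst.
  apply/funext => n; rewrite /flow_sum big1// => i _.
  by case: i => //= i; rewrite mulr0 mul0r.
have Fy : L <= F y.
  apply: (le_trans (ltW Ly)); apply: nondecreasing_cvgn_le.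
    by move=> m n; apply: flow_sum_nondecreasing; exact: ltW.
  by apply: cvg_flow_sum => //; exact: ltW.
have [|x] := IVT (ltW y0) Fcont (v := L).
  by rewrite F0 min_l ?max_r ?Fy ?(ltW L0)// (le_trans (ltW L0)).
rewrite in_itv/= => /andP[x0 xy] FxL; exists x; split; last 2 first.
- by lra.
- rewrite -FxL -EFin_lim; last by apply: (cvg_flow_sum wS x0); lra.
  by congr (limn _); apply/funext => n /=; rewrite sumEFin.
rewrite lt_neqAle x0 andbT; apply: contraTneq L0 => x0'.
by rewrite -FxL -x0' F0 ltxx.
Unshelve. all: by end_near. Qed.

End flow_bounds.

(** * Stationary regimes expressed by the flow *)

Lemma nneseriesS (R : realType) (f : nat -> \bar R) :
  (forall i, (1 <= i)%N -> 0 <= f i)%E ->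
  (\sum_(1 <= i <oo) f i = \sum_(0 <= i <oo) f i.+1)%E.
Proof.
move=> f0; apply/esym/cvg_lim => //.
rewrite (_ : (fun n => _) = (fun n => \sum_(1 <= i < n.+1) f i)%E).
  rewrite (cvg_shiftS (fun n => \sum_(1 <= i < n) f i)%E).
  by apply: is_cvg_nneseries => i i1 _; exact: f0.
by apply/funext => n; rewrite big_add1.
Qed.

Lemma nneseries1 (R : realType) (f : nat -> R) :
  (forall i, 0 <= f i) -> f 0%N = 0 ->
  (\sum_(1 <= i <oo) (f i)%:E = \sum_(0 <= i <oo) (f i)%:E)%E.
Proof.
move=> f0 f00; rewrite [RHS]nneseries_recl ?f00 ?add0e// => i _.
by rewrite lee_fin.
Qed.

(* A stationary regime with total weight K has selection probabilities
   (lambda / alpha) * flow a (tail phi) x, where x = alpha / (mu * K). *)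
Lemma ergodicP (R : realType) (lambda mu alpha : R) (phi a : nat -> R) :
  0 < lambda -> 0 < mu -> 0 < alpha -> proba_pos phi ->
  (forall i, (1 <= i)%N -> 0 < a i) ->
  ergodic lambda mu alpha phi a <->
  (\sum_(0 <= n <oo) (tail phi n)%:E < +oo)%E /\
  exists2 x, 0 < x &
    (\sum_(0 <= n <oo) (flow a (tail phi) x n)%:E = (alpha / lambda)%:E)%E.
Proof.
move=> l0 m0 al0 phiP a0; have t0 n := tail_ge0 n phiP.
have [l_neq0 m_neq0 al_neq0] : [/\ lambda != 0, mu != 0 & alpha != 0].
  by rewrite !gt_eqF.
split=> [[r [st rfin p1]]|[tfin [x x0 fx]]]; last first.
  have x_neq0 : x != 0 by rewrite gt_eqF.
  have f0 i : 0 <= flow a (tail phi) x i by apply: flow_ge0 => //; exact: ltW.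
  (* The stationary recursion read backwards: [r n] is determined by the flow and the tail at the
     preceding index. *)
  pose r n := lambda / mu * (flow a (tail phi) x n.-1 + tail phi n.-1).
  have r0 i : 0 <= r i by rewrite mulr_ge0 ?addr_ge0// divr_ge0// ltW.
  (* The flow recursion makes [a j * r j] a multiple of the flow at [j], so the prescribed sum of
     the flow fixes the total weight. *)
  have KE : total_weight a r = (alpha / (mu * x))%:E.
    rewrite /total_weight (_ : (fun n => _) = fun n => (\sum_(1 <= j < n)
        (lambda / (mu * x))%:E * (flow a (tail phi) x j)%:E)%E).
      rewrite nneseriesZl => [|i _]; last by rewrite lee_fin.
      rewrite nneseries1// fx -EFinM; congr EFin.
      by field; rewrite ?x_neq0 ?l_neq0 ?m_neq0.
    apply/funext => n; apply: eq_big_nat => -[//|i] _.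
    rewrite -EFinM; congr EFin; rewrite /r/=.
    by field; rewrite ?x_neq0 ?m_neq0.
  have selE i : selection a r i = lambda / alpha * flow a (tail phi) x i.
    rewrite /selection KE; case: i => [|i] /=; first by rewrite mulr0.
    by rewrite /r/=; field; rewrite ?x_neq0 ?l_neq0 ?m_neq0 ?al_neq0.
  exists r; split.
  - case=> // i _; split=> //; rewrite /drift !selE/= tailS// /r/=.
    by field; rewrite ?m_neq0 ?al_neq0.
  - rewrite nneseriesS => [|i _]; last by rewrite lee_fin.
    rewrite (_ : (fun n => _) = fun n => (\sum_(0 <= j < n) (lambda / mu)%:E *
        ((flow a (tail phi) x j)%:E + (tail phi j)%:E))%E); last first.
      by apply/funext => n; apply: eq_bigr => i _; rewrite -EFinD -EFinM.
    rewrite nneseriesZl => [|i _]; last by rewrite adde_ge0 ?lee_fin.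
    rewrite nneseriesD => [|i _ _|i _ _]; [|by rewrite lee_fin..].
    by rewrite fx (nneseries_fin (fun i _ => t0 i) tfin) -EFinD -EFinM ltry.
  - rewrite (_ : (fun n => _) = fun n => (\sum_(1 <= j < n)
        (lambda / alpha)%:E * (flow a (tail phi) x j)%:E)%E).
      rewrite nneseriesZl => [|i _]; last by rewrite lee_fin.
      rewrite nneseries1// fx -EFinM; congr EFin.
      by field; rewrite ?l_neq0 ?al_neq0.
    by apply/funext => n; apply: eq_bigr => i _; rewrite selE -EFinM.
have r0 i : (1 <= i)%N -> 0 <= r i by move=> /st[].
set p := selection a r in p1.
have K0 : 0 <= fine (total_weight a r).
  apply/fine_ge0/nneseries_ge0 => i i1 _.
  by rewrite lee_fin mulr_ge0 ?r0// ltW// a0.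
have p0 i : 0 <= p i.
  rewrite /p/selection; case: i => //= i.
  by rewrite divr_ge0// mulr_ge0 ?r0// ltW// a0.
(* A total weight of 0 or [+oo] has [fine] equal to 0; all selection probabilities would then vanish
   and could not sum to 1. *)
have Kgt0 : 0 < fine (total_weight a r).
  rewrite lt_neqAle K0 andbT; apply/eqP => K00.
  move: p1; rewrite eseries0; first by move=> [] /esym/eqP; rewrite oner_eq0.
  by move=> i _ _; rewrite /p/selection -K00 invr0 mulr0 if_same.
set K := fine _ in K0 Kgt0.
(* The fixed-point equations telescope: [mu * r n.+1 - lambda * tail phi n - alpha * p n] does not
   depend on [n]. *)
have bal n :
    mu * r n.+1 = mu * r 1%N - lambda + lambda * tail phi n + alpha * p n.
  elim: n => [|n IH]; first by rewrite tail0// /p/selection/=; ring.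
  have [_] := st n.+1 isT; rewrite /drift/= -/p tailS// => H.
  lra.
(* This constant is the limit of three sequences tending to 0, as [r] and [p] are summable and the
   tails vanish. *)
have mur1 : mu * r 1%N - lambda = 0.
  have : mu * r n.+1 - lambda * tail phi n - alpha * p n @[n --> \oo] -->
      mu * 0 - lambda * 0 - alpha * 0.
    apply: cvgB; first apply: cvgB.
    - apply: cvgMr; rewrite (cvg_shiftS r); exact: nneseries_cvg0 r0 rfin.
    - apply: cvgMr; exact: cvg_tail.
    - apply: cvgMr; apply: (@nneseries_cvg0 _ p 1%N) => //.
      by rewrite p1 ltry.
  rewrite !mulr0 !subr0.
  rewrite (_ : (fun n => _) = cst (mu * r 1%N - lambda)); last first.
    by apply/funext => n /=; rewrite bal; ring.
  by move=> /cvg_lim <-//; rewrite lim_cst.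
have {}bal n : r n.+1 = (lambda * tail phi n + alpha * p n) / mu.
  by apply: (mulfI m_neq0); rewrite bal mur1 add0r mulrCA divff ?mulr1.
have pE n : p n = lambda / alpha * flow a (tail phi) (alpha / (mu * K)) n.
  elim: n => [|n IH]; first by rewrite mulr0.
  have -> : p n.+1 = a n.+1 * r n.+1 / K by [].
  rewrite bal IH /=.
  by field; rewrite al_neq0 m_neq0 gt_eqF.
split; last first.
  exists (alpha / (mu * K)); first by rewrite divr_gt0// mulr_gt0.
  rewrite (_ : (fun n => _) = fun n => (\sum_(0 <= j < n)
      (alpha / lambda)%:E * (p j)%:E)%E).
    rewrite nneseriesZl//; last by move=> i _; rewrite lee_fin.
    by rewrite -nneseries1// p1 mule1.
  apply/funext => n; apply: eq_bigr => i _; rewrite -EFinM pE; congr EFin.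
  by field; rewrite ?l_neq0 ?al_neq0.
(* By [bal], [tail phi n] is at most [mu / lambda * r n.+1], so the tails inherit summability from
   [r]. *)
have rE := nneseries_fin r0 rfin; set M := fine _ in rE.
apply: (@le_lt_trans _ _ (mu / lambda * M)%:E); last exact: ltry.
apply: nneseries_le_ub => // n.
apply: (@le_trans _ _ (mu / lambda * \sum_(1 <= i < n.+1) r i)).
  rewrite big_add1 /= mulr_sumr; apply: ler_sum => i _; rewrite bal.
  rewrite (_ : mu / lambda * _ = tail phi i + alpha / lambda * p i); last first.
    by field; rewrite ?l_neq0 ?m_neq0.
  by rewrite lerDl mulr_ge0// divr_ge0// ltW.
apply: ler_wpM2l; first by rewrite divr_ge0// ltW.
by rewrite -lee_fin -rE; exact: sum_le_nneseries.
Qed.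

(** * Weights tending to 1 and the ergodicity criterion *)

Lemma weight_le1 (R : realType) (a : nat -> R) :
  (forall i j, (1 <= i)%N -> (i <= j)%N -> a i <= a j) ->
  a @ \oo --> (1 : R) -> forall i, (1 <= i)%N -> a i <= 1.
Proof.
move=> nda al i i1; rewrite -(cvg_lim _ al)//.
apply: limr_ge; first by apply/cvg_ex; exists 1.
by near=> n; apply: nda => //; near: n; exact: nbhs_infty_ge.
Unshelve. all: by end_near. Qed.

(* If 1 < x then a_n x >= 1 eventually, so the flow is eventually
   nondecreasing and positive. *)
Lemma flow_series_le1 (R : realType) (a w : nat -> R) (x : R) :
  (forall i, (1 <= i)%N -> 0 < a i) -> a @ \oo --> (1 : R) ->
  (forall i, 0 <= w i) -> 0 < w 0%N -> 0 < x ->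
  (\sum_(0 <= n <oo) (flow a w x n)%:E < +oo)%E -> x <= 1.
Proof.
move=> a0 al w0 w00 x0 fin; rewrite leNgt; apply/negP => x1.
have f0 i : 0 <= flow a w x i by apply: flow_ge0 => //; exact: ltW.
have fpos n : 0 < flow a w x n.+1.
  elim: n => [|n IH].
    by rewrite /= add0r !mulr_gt0 ?a0.
  rewrite [ltRHS]/(a n.+2 * x * (flow a w x n.+1 + w n.+1)).
  by rewrite mulr_gt0 ?mulr_gt0 ?a0// ltr_pwDl.
have [N _ aN] : \forall n \near \oo, x^-1 < a n.
  by apply: (cvgr_gt _ al); rewrite invf_lt1.
have nd n : (N <= n)%N -> flow a w x N.+1 <= flow a w x n.+1.
  elim: n => [|n IH]; first by rewrite leqn0 => /eqP ->.
  rewrite leq_eqVlt => /predU1P[<-//|Nn]; apply: (le_trans (IH Nn)).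
  rewrite [leRHS]/(a n.+2 * x * (flow a w x n.+1 + w n.+1)).
  have ax : 1 <= a n.+2 * x.
    by rewrite -ler_pdivrMr// div1r ltW//; apply: aN => /=; lia.
  apply: le_trans (ler_peMl _ ax); first by rewrite lerDl.
  by rewrite addr_ge0.
have c0 : flow a w x n @[n --> \oo] --> 0.
  exact: (@nneseries_cvg0 _ _ 0%N).
(* Past both thresholds, the flow would be at once below [flow a w x N.+1], since it tends to 0, and
   at least that value. *)
have [M _ /(_ (maxn M N).+1)] :
    \forall n \near \oo, flow a w x n < flow a w x N.+1.
  exact: (cvgr_lt _ c0).
have := nd (maxn M N) (leq_maxr _ _).
by rewrite leNgt => /negP h /(_ (leqW (leq_maxl _ _))) /h.
Qed.

(** The terms with [j + k = n] add up to the closed form of the flow at [x = 1]. *)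
Lemma sum_weight_prodE (R : realType) (a w : nat -> R) :
  (forall i, (1 <= i)%N -> 0 < a i) -> (forall i, 0 <= w i) ->
  (\sum_(1 <= k <oo) \sum_(0 <= j <oo)
      (weight_prod a (j + k) * w j / weight_prod a j)%:E =
   \sum_(0 <= n <oo) (flow a w 1 n)%:E)%E.
Proof.
move=> a0 w0.
pose f n j := (weight_prod a n * w j / weight_prod a j)%:E.
rewrite (@nneseries_diag _ f) => [|n j]; last first.
  by rewrite lee_fin divr_ge0 ?mulr_ge0// ltW// weight_prod_gt0.
by apply: eq_eseriesr => n _; rewrite flow1E// sumEFin.
Qed.

Unset Implicit Arguments.

Theorem theorem3p3 (R : realType) (lambda mu alpha : R) (phi a : nat -> R)
    (lambda_gt0 : 0 < lambda) (mu_gt0 : 0 < mu) (alpha_gt0 : 0 < alpha)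
    (phi_proba : proba_pos phi)
    (a_gt0 : forall i, (1 <= i)%N -> 0 < a i)
    (a_nondecreasing : forall i j, (1 <= i)%N -> (i <= j)%N -> a i <= a j)
    (a_lim : a @ \oo --> (1 : R)) :
  (genfun_deriv1 phi = +oo%E -> ~ ergodic lambda mu alpha phi a) /\
  ((genfun_deriv1 phi < +oo)%E ->
     (ergodic lambda mu alpha phi a <->
      ((alpha / lambda)%:E <=
        \sum_(1 <= k <oo) \sum_(0 <= j <oo)
          (weight_prod a (j + k) * tail phi j / weight_prod a j)%:E)%E)).
Proof.
have t0 i := tail_ge0 i phi_proba.
have a1 := weight_le1 a_nondecreasing a_lim.
have ergP := ergodicP lambda_gt0 mu_gt0 alpha_gt0 phi_proba a_gt0.
split=> [dphi /ergP[tfin _]|dphi].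
  exact: genfun_deriv1_fin tfin dphi.
have tfin : (\sum_(0 <= n <oo) (tail phi n)%:E < +oo)%E.
  rewrite ltey; apply/eqP => /(genfun_deriv1_infty phi_proba) d.
  by move: dphi; rewrite d ltxx.
have tS n : \sum_(0 <= i < n) tail phi i <=
    fine (\sum_(0 <= i <oo) (tail phi i)%:E)%E.
  rewrite -lee_fin -nneseries_fin//.
  exact: sum_le_nneseries.
rewrite sum_weight_prodE//; split=> [/ergP[_ [x x0 fx]]|Lf].
  (* Necessity: once [x <= 1], termwise monotonicity in [x] compares the series with its value at
     1. *)
  have x1 : x <= 1.
    apply: (flow_series_le1 a_gt0 a_lim t0 _ x0); last by rewrite fx ltry.
    by rewrite tail0.
  rewrite -fx; apply: lee_nneseries => [i _ _|i _]; rewrite lee_fin.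
    by apply: flow_ge0 => //; exact: ltW.
  by apply: ler_flow => //; exact: ltW.
(* Sufficiency: the intermediate value theorem supplies the required [x]. *)
apply/ergP; split=> //.
have [|x [x0 _ fx]] := flow_series_ivt a_gt0 a1 t0 tS _ Lf.
  exact: divr_gt0.
by exists x.
Qed.
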